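(* Let $a$ be a positive integer and suppose that $a\,T_k(m)=(2m+1)^k$ with positive integers $m>1$ and even $k$. Let $p$ be a prime dividing $2m+1$. Then: (a) $p$ is an irregular prime; (b) $k\not\equiv 0,2,4,6,8,10,14\pmod{p-1}$; (c) $\operatorname{ord}_p(B_k/k)\ge 2\operatorname{ord}_p(2m+1)\ge 2$; (d) $k\equiv r\pmod{p-1}$ for some irregular pair $(r,p)$.
   Context: $T_k(m):=\sum_{j=1}^{m}(2j-1)^k$. Bernoulli numbers $B_j$ are defined by $\frac{z}{e^z-1}=\sum_{j\ge0}B_j\frac{z^j}{j!}$ ($|z|<2\pi$); write $B_j=U_j/V_j$ with $\gcd(U_j,V_j)=1$, $V_j>0$. $\operatorname{ord}_p$ denotes the $p$-adic valuation (on nonzero rationals). An odd prime $p$ is irregular if $p\mid U_r$ for some even $r\le p-3$; the pairs $(r,p)$ with $p\mid U_r$ and $r$ even, $r\le p-3$, are called irregular pairs. *)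

(* Defs.v *)
From Stdlib Require Import Reals.
From Coquelicot Require Import Coquelicot.
From mathcomp Require Import all_boot all_order all_algebra.
From mathcomp Require Import Rstruct.

Set Implicit Arguments.
Unset Strict Implicit.
Unset Printing Implicit Defensive.

Import Order.TTheory GRing.Theory Num.Theory.

(* e^(x + iy) = e^x (cos y + i sin y) *)
Definition cexp (z : C) : C :=
  (Rmult (exp z.1) (cos z.2), Rmult (exp z.1) (sin z.2)).

(* B is the sequence of Bernoulli numbers: z / (e^z - 1) = \sum_j B_j z^j / j!
   for complex |z| < 2 pi.  At z = 0 the left-hand side is a removable
   singularity, whose value follows by continuity (B_0 = 1); since division by
   zero is total here, z = 0 has to be left out. *)
Definition bernoulli_numbers (B : nat -> rat) : Prop :=
  forall z : C, z <> RtoC 0 -> Rlt (Cmod z) (Rmult 2 PI) ->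
    is_pseries (K := C_AbsRing) (V := C_NormedModule)
      (fun j => RtoC (Rdiv (ratr (B j)) (INR j`!)))
      z (Cdiv z (Cminus (cexp z) (RtoC 1))).

Local Open Scope ring_scope.

Definition T (k m : nat) : nat := (\sum_(1 <= j < m.+1) (2 * j - 1) ^ k)%N.

(* The p-adic valuation of x.  It is meaningful for p prime and x != 0; at
   x = 0 it takes the junk value 0, so a positive lower bound on it entails
   x != 0. *)
Definition padic_ord (p : nat) (x : rat) : int :=
  (logn p `|numq x|)%:Z - (logn p `|denq x|)%:Z.

(* numq (B r) is the numerator U_r of B_r in lowest terms. *)
Definition irregular_pair (B : nat -> rat) (r p : nat) : Prop :=
  [/\ prime p, odd p, ~~ odd r, (r <= p - 3)%N & (p%:Z %| numq (B r))%Z].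

Definition irregular (B : nat -> rat) (p : nat) : Prop :=
  [/\ prime p, odd p & exists r, irregular_pair B r p].

(* Main.v *)
(* Both T_k(m) and 1^k + ... + (n-1)^k are values of the polynomial
     P_k(x) = \sum_i C(k,i) B_(k-i) x^(i+1) / (i+1),
   and T_k(m) = 2^k P_k(N/2) with N = 2m+1, because P_k(1/2) = 0 for even k.
   The size estimate T_k(m) >= (N-2)^k gives a <= (5/3)^k, so a is too small to
   absorb the p-part of N^k, and T_k(m) is divisible by the p-part of k N^3.
   Dividing the expansion of P_k(N/2) by kN, all terms but 2^(k-1) B_k/k have
   p-adic order at least 2 ord_p(N), except that the term carrying B_(k-2) may
   lose one factor p.  Thus p - 1 does not divide k (otherwise B_k would have p in
   its denominator) and p | B_k/k; Kummer's congruence moves this to the residue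
   r of k mod p - 1, so (r,p) is an irregular pair.  In particular k is not 2 mod
   p - 1, hence B_(k-2) is p-integral and no factor p is lost.
   Kummer's congruence comes from Voronoi's: multiplication by a permutes the
   residues mod p^2, and writing aj = q p^2 + r makes
   (a^k - 1) B_k/k = \sum_j q r^(k-1) mod p visible, where the right-hand side
   depends only on k mod p - 1. *)
From HB Require Import structures.
From Stdlib Require Import Reals Lra.
From Coquelicot Require Import Coquelicot.
Require Import Defs.
From mathcomp Require Import all_boot all_order all_algebra all_solvable.
From mathcomp Require Import Rstruct.

Set Implicit Arguments.
Unset Strict Implicit.
Unset Printing Implicit Defensive.

(** * The Bernoulli recurrence *)

Local Open Scope R_scope.

Definition bcoef (B : nat -> rat) (n : nat) : R := Rdiv (ratr (B n)) (INR n`!).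

Lemma cexp_real (x : R) : cexp (RtoC x) = RtoC (exp x).
Proof. by rewrite /cexp /RtoC /= cos_0 sin_0 Rmult_1_r Rmult_0_r. Qed.

(** The real part is continuous and additive, so the complex expansion restricts to a real one on
    the real axis. *)
Lemma is_series_fst (u : nat -> C) (l : C) :
  is_series (K := C_AbsRing) (V := C_NormedModule) u l -> is_series (fun n => fst (u n)) (fst l).
Proof.
move=> H.
rewrite /is_series; apply: (filterlim_ext (fun n => fst (sum_n u n))).
- elim=> [|n IH]; first by rewrite !sum_O.
  by rewrite !sum_Sn -IH.
- apply: (filterlim_comp _ _ _ _ _ _ _ _ H).
  move=> P [eps HP]; exists eps => y [Hy _]; exact: HP.
Qed.

Lemma bernoulli_real (B : nat -> rat) (hB : bernoulli_numbers B) (x : R) :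
  x <> 0 -> Rabs x < 2 * PI -> is_pseries (bcoef B) x (x / (exp x - 1)).
Proof.
move=> x0 xpi.
have /hB : RtoC x <> RtoC 0 by move=> /RtoC_inj.
rewrite Cmod_R => /(_ xpi) /is_series_fst.
have e0 : exp x - 1 <> 0.
  by move=> H; apply: x0; apply: exp_inv; rewrite exp_0; lra.
rewrite cexp_real -RtoC_minus -RtoC_div // => H.
apply: is_series_ext H => n.
have -> : pow_n (K := C_AbsRing) (RtoC x) n = RtoC (pow_n x n).
  by elim: n => //= n ->; rewrite /mult /= RtoC_mult.
by rewrite /scal /= /mult /= -/(bcoef B n) Rmult_0_l Rminus_0_r.
Qed.

(** The terms of a convergent series tend to 0, which fails outside the disk of convergence. *)
Lemma CV_radius_ge (a : nat -> R) (x : R) :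
  ex_pseries a x -> Rbar_le (Rabs x) (CV_radius a).
Proof.
move=> H; apply: Rbar_not_lt_le => /CV_disk_outside; apply.
have := ex_series_lim_0 _ H.
apply: is_lim_seq_ext => n.
by rewrite /scal /= /mult /= pow_n_pow Rmult_comm.
Qed.

(** The point 0 is left out because x / (e^x - 1) takes a junk value there; the hypothesis on the
    constant coefficients makes up for it. *)
Lemma is_pseries_coef_unique (a b : nat -> R) (f : R -> R) :
  a 0%N = b 0%N ->
  (forall x, x <> 0 -> Rabs x < 1 -> is_pseries a x (f x)) ->
  (forall x, x <> 0 -> Rabs x < 1 -> is_pseries b x (f x)) ->
  forall n, a n = b n.
Proof.
move=> ab0 Ha Hb n.
have rad c : (forall x, x <> 0 -> Rabs x < 1 -> is_pseries c x (f x)) ->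
    Rbar_lt 0 (CV_radius c).
  move=> Hc; apply: (Rbar_lt_le_trans _ (Rabs (/ 2))).
    by rewrite /= Rabs_pos_eq; lra.
  apply: CV_radius_ge; exists (f (/2)); apply: Hc; first lra.
  by rewrite Rabs_pos_eq; lra.
apply: PSeries_ext_recip; [exact: rad | exact: rad |].
exists (mkposreal 1 Rlt_0_1) => x.
rewrite /ball /= /AbsRing_ball /= /abs /minus /plus /opp /= => Hx.
have [->|x0] := Req_dec x 0; first by rewrite !PSeries_0.
have x1 : Rabs x < 1 by rewrite -[x]Rminus_0_r.
by rewrite (is_pseries_unique _ _ _ (Ha x x0 x1)) (is_pseries_unique _ _ _ (Hb x x0 x1)).
Qed.

Definition expcoef (n : nat) : R := / INR (Factorial.fact n).
Definition xcoef (n : nat) : R := if n == 1%N then 1 else 0.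

Lemma is_pseries_xcoef (x : R) : is_pseries xcoef x x.
Proof.
have E n : sum_n (fun k => scal (pow_n x k) (xcoef k)) n.+1 = x :> R.
  elim: n => [|n IH]; rewrite sum_Sn ?sum_O ?IH /scal /plus /= /mult /= /xcoef /=.
    by rewrite /one /= Rmult_0_r Rplus_0_l !Rmult_1_r.
  by rewrite Rmult_0_r Rplus_0_r.
apply: (filterlim_ext_loc (fun=> x)); last exact: filterlim_const.
by exists 1%N => -[|n] n1; [inversion n1 | rewrite E].
Qed.

Lemma one_lt_2PI : 1 < 2 * PI.
Proof. have := PI2_1; lra. Qed.

Lemma bernoulli_near (B : nat -> rat) (hB : bernoulli_numbers B) (x : R) :
  x <> 0 -> Rabs x < 1 -> is_pseries (bcoef B) x (x / (exp x - 1)).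
Proof.
move=> x0 x1; apply: bernoulli_real => //; have := one_lt_2PI; lra.
Qed.

(** Coefficients are compared in x / (e^x - 1) * e^x = x / (e^x - 1) + x. *)
Lemma bernoulli_mul_exp (B : nat -> rat) (hB : bernoulli_numbers B) (n : nat) :
  PS_mult (bcoef B) expcoef n = bcoef B n + xcoef n.
Proof.
apply: (@is_pseries_coef_unique (PS_mult (bcoef B) expcoef)
  (PS_plus (bcoef B) xcoef) (fun x => x / (exp x - 1) + x)).
- by rewrite /PS_mult /PS_plus /= /plus /= /expcoef /xcoef /=; field.
- move=> x x0 x1.
  have e0 : exp x - 1 <> 0.
    by move=> H; apply: x0; apply: exp_inv; rewrite exp_0; lra.
  have -> : x / (exp x - 1) + x = x / (exp x - 1) * exp x by field.
  apply: is_pseries_mult.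
  + exact: bernoulli_near.
  + exact: is_exp_Reals.
  (* The midpoint of |x| and 1 is still a point of convergence, so the radius exceeds |x|
     strictly. *)
  + apply: (Rbar_lt_le_trans _ (Rabs ((1 + Rabs x) / 2))).
      by have := Rabs_pos x => p; rewrite /= [X in _ < X]Rabs_pos_eq; lra.
    have p := Rabs_pos x.
    apply: CV_radius_ge; eexists; apply: bernoulli_near => //; first lra.
    rewrite Rabs_pos_eq; lra.
  + apply: (Rbar_lt_le_trans _ (Rabs (1 + Rabs x))).
      by have := Rabs_pos x => p; rewrite /= [X in _ < X]Rabs_pos_eq; lra.
    by apply: CV_radius_ge; eexists; exact: is_exp_Reals.
- move=> x x0 x1; apply: is_pseries_plus; first exact: bernoulli_near.
  exact: is_pseries_xcoef.
Qed.

(** Replacing x by -x in x / (e^x - 1) adds x. This is the source of the vanishing of B_n for odd n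
    other than 1. *)
Lemma bernoulli_reflect (B : nat -> rat) (hB : bernoulli_numbers B) (n : nat) :
  (-1) ^ n * bcoef B n = bcoef B n + xcoef n.
Proof.
apply: (@is_pseries_coef_unique (fun n => (-1) ^ n * bcoef B n)
  (PS_plus (bcoef B) xcoef) (fun x => x / (exp x - 1) + x)).
- by rewrite /PS_plus /= /plus /= /xcoef /=; ring.
- move=> x x0 x1.
  have e0 : exp x - 1 <> 0.
    by move=> H; apply: x0; apply: exp_inv; rewrite exp_0; lra.
  have e1 : exp x <> 0 by have := exp_pos x; lra.
  have -> : x / (exp x - 1) + x = (- x) / (exp (- x) - 1).
    rewrite exp_Ropp; field; split=> //; split=> //; lra.
  have /(_ _ _)/is_series_ext := @bernoulli_near B hB (- x); apply.
  + move=> k; rewrite /scal /= /mult /= !pow_n_pow.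
    have -> : - x = (-1) * x by ring.
    rewrite Rpow_mult_distr; ring.
  + by move=> H; apply: x0; lra.
  + by rewrite Rabs_Ropp.
- move=> x x0 x1; apply: is_pseries_plus; first exact: bernoulli_near.
  exact: is_pseries_xcoef.
Qed.

Local Close Scope R_scope.
From mathcomp Require Import zify ring lra.
Import Order.TTheory GRing.Theory Num.Theory.
Local Open Scope ring_scope.

(** The arithmetic below rests on this identity and on the vanishing at odd indices, no longer on
    the analytic definition. *)
Definition bernoulli_recurrence (B : nat -> rat) : Prop :=
  forall n, \sum_(j < n) 'C(n, j)%:R * B j = (n == 1%N)%:R.

Lemma bcoefE B n : bcoef B n = ratr (B n) / n`!%:R.
Proof. by rewrite /bcoef INRE. Qed.

Lemma bernoulli_rec (B : nat -> rat) (hB : bernoulli_numbers B) :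
  bernoulli_recurrence B.
Proof.
move=> n.
have f0 k : k`!%:R != 0 :> R by rewrite pnatr_eq0 -lt0n fact_gt0.
have := bernoulli_mul_exp hB n.
rewrite /PS_mult sum_f_R0E big_mkord big_ord_recr /= bcoefE /expcoef.
(* The last term of the Cauchy product cancels against B_n / n!, which is why the recurrence stops
   before j = n. *)
rewrite Nat.sub_diag /= Rinv_1 Rmult_1_r addrC => /addrI H.
apply: (fmorph_inj (@ratr R)); apply: (mulIf (invr_neq0 (f0 n))).
rewrite rmorph_sum /= mulr_suml rmorph_nat.
have -> : (n == 1%N)%:R / n`!%:R = xcoef n.
  rewrite /xcoef; case: eqP => [->|_]; last by rewrite mul0r.
  by rewrite /= divr1.
rewrite -H; apply: eq_bigr => j _.
rewrite rmorphM /= rmorph_nat bcoefE factE INRE RinvE RmultE minusE.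
have jn : (j <= n)%N by rewrite ltnW.
by rewrite -(bin_fact jn) !natrM; field; rewrite !f0 pnatr_eq0 -lt0n bin_gt0 jn.
Qed.

Lemma bernoulli_odd (B : nat -> rat) (hB : bernoulli_numbers B) (n : nat) :
  odd n -> n != 1%N -> B n = 0.
Proof.
move=> on n1; have := bernoulli_reflect hB n.
rewrite RpowE /xcoef (negPf n1) -signr_odd on bcoefE.
move=> H; apply/eqP; rewrite -(fmorph_eq0 (@ratr R)).
have f0 : n`!%:R != 0 :> R by rewrite pnatr_eq0 -lt0n fact_gt0.
have : ratr (B n) / n`!%:R = 0 :> R.
  move: H; rewrite RplusE RmultE expr1 mulN1r addr0 => H; lra.
by move=> /eqP; rewrite mulf_eq0 invr_eq0 (negPf f0) orbF.
Qed.

(** * Faulhaber's formula *)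

(** Written in ascending powers of x, so that for p dividing x the powers of p grow along the
    sum. *)
Definition faulhaber (B : nat -> rat) (k : nat) (x : rat) : rat :=
  \sum_(i < k.+1) 'C(k, i)%:R * B (k - i)%N * x ^+ i.+1 / i.+1%:R.

Lemma natr_neq0 n : n.+1%:R != 0 :> rat.
Proof. by rewrite pnatr_eq0. Qed.

Lemma bin_div_succ k i : 'C(k, i)%:R / i.+1%:R = 'C(k.+1, i.+1)%:R / k.+1%:R :> rat.
Proof.
apply/eqP; rewrite eqr_div ?natr_neq0 // -!natrM eqr_nat.
by rewrite mulnC mul_bin_diag mulnC.
Qed.

(** The right-hand side is B_(k+1)(x) - B_(k+1) in terms of Bernoulli polynomials. *)
Lemma faulhaberE B k (x : rat) :
  k.+1%:R * faulhaber B k x = \sum_(l < k.+2) 'C(k.+1, l)%:R * B (k.+1 - l)%N * x ^+ l - B k.+1.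
Proof.
rewrite big_ord_recl /= bin0 subn0 expr0 mulr1 mul1r addrC addKr mulr_sumr.
apply: eq_bigr => i _; rewrite /bump /= add1n subSS.
have := bin_div_succ k i; have := natr_neq0 k; have := natr_neq0 i => i0 k0 e.
have -> : 'C(k.+1, i.+1)%:R = 'C(k, i)%:R / i.+1%:R * k.+1%:R :> rat.
  by rewrite e divfK.
ring.
Qed.

Lemma bin_trans n l s : (s <= l <= n)%N ->
  ('C(n, l) * 'C(l, s) = 'C(n, s) * 'C(n - s, n - l))%N.
Proof.
case/andP=> sl ln; have sn := leq_trans sl ln.
have e : ((n - s) - (n - l) = l - s)%N by lia.
have h : (n - l <= n - s)%N by lia.
apply/eqP; rewrite -(eqn_pmul2r (fact_gt0 s)) -(eqn_pmul2r (fact_gt0 (l - s))).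
rewrite -(eqn_pmul2r (fact_gt0 (n - l))).
have := bin_fact ln; have := bin_fact sl; have := bin_fact sn; have := bin_fact h; rewrite e.
move=> H1 H2 H3 H4; apply/eqP.
transitivity n`!; last by rewrite -H2 -H1; ring.
by rewrite -H4 -H3; ring.
Qed.

Lemma bin_trans_rev n j s : (j <= n)%N -> (s <= n)%N ->
  ('C(n, n - j) * 'C(n - j, s) = 'C(n, s) * 'C(n - s, j))%N.
Proof.
move=> jn sn; have [sj|sj] := leqP s (n - j).
  have h : (s <= n - j <= n)%N by rewrite sj leq_subr.
  by rewrite (bin_trans h) (subKn jn).
by rewrite [X in (_ * X = _)%N]bin_small // [X in _ = (_ * X)%N]bin_small ?muln0 //; lia.
Qed.

(** Binomials vanish beyond d, so the range can be made independent of d; this allows sums to be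
    exchanged. *)
Lemma bernoulli_rec_wide B (hB : bernoulli_recurrence B) d M : (d < M)%N ->
  \sum_(j < M) 'C(d, j)%:R * B j = (d == 1%N)%:R + B d.
Proof.
move=> dM; rewrite -(subnKC dM) big_split_ord /= [X in _ + X]big1 => [|i _].
  by rewrite addr0 big_ord_recr /= hB binn mul1r.
by rewrite bin_small ?mul0r //; lia.
Qed.

Lemma exprD1_wide (x : rat) l M : (l < M)%N ->
  (x + 1) ^+ l = \sum_(s < M) 'C(l, s)%:R * x ^+ s.
Proof.
move=> lM; rewrite -(subnKC lM) big_split_ord /= [X in _ = _ + X]big1 => [|i _].
  rewrite addr0 [x + 1]addrC exprDn; apply: eq_bigr => i _.
  by rewrite expr1n mul1r mulr_natl.
by rewrite bin_small ?mul0r //; lia.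
Qed.

(** With n = k+1, the coefficient of x^s in B_n(x+1) is C(n,s) \sum_j C(n-s,j) B_j, where j = n-l.
    By the recurrence it differs from that of B_n(x) only when n-s = 1, i.e. s = k. *)
Lemma faulhaber_step B (hB : bernoulli_recurrence B) k (x : rat) :
  faulhaber B k (x + 1) - faulhaber B k x = x ^+ k.
Proof.
apply: (mulfI (natr_neq0 k)); rewrite mulrBr !faulhaberE.
rewrite opprB addrA subrK; set n := k.+1.
have E (l : 'I_n.+1) : 'C(n, l)%:R * B (n - l)%N * (x + 1) ^+ l =
    \sum_(s < n.+1) x ^+ s * ('C(n, l) * 'C(l, s))%:R * B (n - l)%N.
  rewrite (@exprD1_wide _ _ n.+1) // mulr_sumr.
  by apply: eq_bigr => s _; rewrite natrM; ring.
rewrite (eq_bigr _ (fun l _ => E l)) exchange_big /= -sumrB.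
have F (s : 'I_n.+1) : \sum_(l < n.+1) x ^+ s * ('C(n, l) * 'C(l, s))%:R * B (n - l)%N
    - 'C(n, s)%:R * B (n - s)%N * x ^+ s = (s == k :> nat)%:R * (n%:R * x ^+ s).
  have sn : (s <= n)%N by rewrite -ltnS.
  rewrite (reindex_inj rev_ord_inj) /=.
  rewrite (eq_bigr (fun j : 'I_n.+1 => x ^+ s * 'C(n, s)%:R * ('C(n - s, j)%:R * B j))).
    rewrite -mulr_sumr bernoulli_rec_wide //; last by rewrite ltnS leq_subr.
    have -> : (n - s == 1)%N = (s == k :> nat) by rewrite /n; lia.
    case: eqP => [->|_]; rewrite ?binSn -?/n ?mulr1n ?mulr0n; ring.
  move=> j _; have jn : (j <= n)%N by rewrite -ltnS.
  by rewrite subSS bin_trans_rev // subKn // natrM; ring.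
rewrite (eq_bigr _ (fun s _ => F s)) big_ord_recr /= big_ord_recr /= eqxx.
rewrite big1 => [|i _]; last by rewrite ltn_eqF ?mul0r //=.
by rewrite /n eqn_leq ltnn /=; ring.
Qed.

Lemma faulhaber0 B k : faulhaber B k 0 = 0.
Proof. by rewrite /faulhaber big1 // => i _; rewrite exprS mul0r mulr0 mul0r. Qed.

Lemma sum_powers B (hB : bernoulli_recurrence B) k N :
  (\sum_(j < N) j ^ k)%N%:R = faulhaber B k N%:R.
Proof.
elim: N => [|N IH]; first by rewrite big_ord0 faulhaber0.
rewrite big_ord_recr /= natrD IH -natr1.
rewrite -(subrK (faulhaber B k N%:R) (faulhaber _ _ (_ + 1))).
by rewrite faulhaber_step // natrX addrC.
Qed.

(** For even k one has P_k(-x) = -P_k(x) - x^k: the only even power of x with a nonzero coefficient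
    is x^k, which carries B_1 = -1/2. Together with the step from -1/2 to 1/2 this gives 2 P_k(1/2)
    = 0. *)
Lemma faulhaber_half B (hB : bernoulli_recurrence B)
  (hodd : forall n, odd n -> n != 1%N -> B n = 0) k : ~~ odd k -> (0 < k)%N ->
  faulhaber B k (2%:R^-1) = 0.
Proof.
move=> ek k0.
have b1 : 2%:R * B 1%N = -1.
  have := hB 2; have := hB 1%N; rewrite !big_ord_recr !big_ord0 /= ?bin0 ?bin1; lra.
have neg (x : rat) : faulhaber B k (- x) = - faulhaber B k x - x ^+ k.
  apply/eqP; rewrite addrC -subr_eq opprK -big_split /=; apply/eqP.
  transitivity (\sum_(i < k.+1) (if i.+1 == k :> nat then - x ^+ k else 0)).
    apply: eq_bigr => i _; have ik : (i <= k)%N by rewrite -ltnS.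
    rewrite exprNn -signr_odd /=; case: (boolP (odd i)) => oi /=; last first.
      rewrite expr1; case: eqP => [e|_]; last by ring.
      by have := congr1 odd e; rewrite /= oi (negPf ek).
    rewrite expr0 mul1r; case: eqP => [e|ne]; last first.
      rewrite hodd ?mulr0 ?mul0r ?addr0 ?oddB ?(negPf ek) ?oi //; lia.
    have i0 := natr_neq0 i.
    move: (nat_of_ord i) e i0 => l <- l0.
    by rewrite binSn subSnn -[- (x ^+ _)]mulN1r -b1; field; rewrite nat1r.
  rewrite -big_mkcond /=; case: k k0 {ek} => // k _.
  rewrite (eq_bigl (fun i : 'I_k.+2 => i == inord k)).
    by rewrite big_pred1_eq.
  by move=> i; rewrite -val_eqE /= inordK // eqSS.
have := faulhaber_step hB k (- 2%:R^-1).
rewrite neg exprNn -signr_odd (negPf ek) expr0 mul1r.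
have -> : - 2%:R^-1 + 1 = 2%:R^-1 :> rat by [].
set u := faulhaber _ _ _; move=> h; lra.
Qed.

Lemma T_faulhaber B (hB : bernoulli_recurrence B)
  (hodd : forall n, odd n -> n != 1%N -> B n = 0) k m : ~~ odd k -> (0 < k)%N ->
  (T k m)%:R = 2%:R ^+ k * faulhaber B k ((2 * m + 1)%:R / 2%:R).
Proof.
move=> ek k0; elim: m => [|m IH].
  by rewrite /T big_geq // muln0 add0n mul1r faulhaber_half // mulr0.
have -> : T k m.+1 = (T k m + (2 * m + 1) ^ k)%N.
  by rewrite /T big_nat_recr //=; congr (_ + _ ^ _)%N; lia.
rewrite natrD IH.
have -> : (2 * m.+1 + 1)%:R / 2%:R = (2 * m + 1)%:R / 2%:R + 1 :> rat.
  have -> : (2 * m.+1 + 1 = 2 * m + 1 + 2)%N by lia.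
  by rewrite natrD mulrDl divff.
have := faulhaber_step hB k ((2 * m + 1)%:R / 2%:R).
rewrite expr_div_n => h.
have -> : ((2 * m + 1) ^ k)%:R = 2%:R ^+ k * ((2 * m + 1)%:R ^+ k / 2%:R ^+ k) :> rat.
  by rewrite mulrC divfK ?natrX // expf_neq0.
rewrite -h; ring.
Qed.

(** * p-integral rationals and von Staudt's theorem *)

(** For prime p this is the localization of the integers at p. A congruence x = y mod p between its
    elements is written below as p-integrality of (x - y) / p. *)
Definition pint_pred (p : nat) : {pred rat} := fun x => coprime p `|denq x|.
Definition pint (p : nat) : qualifier 1 rat := [qualify a x | pint_pred p x].

Lemma pintP p x :
  reflect (exists n d, coprime p d /\ (0 < d)%N /\ x = n%:~R / d%:R) (x \is a pint p).
Proof.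
apply: (iffP idP) => [h|[n [d [cd [d0 ->]]]]].
  exists (numq x), `|denq x|%N; split=> //; split; first by rewrite absz_gt0 denq_neq0.
  by rewrite -[LHS]divq_num_den -[_%:R]/(_%:Z%:~R) absz_denq.
rewrite qualifE /= /pint_pred.
have d1 : d%:R != 0 :> rat by rewrite pnatr_eq0 -lt0n.
set y := _ / _.
have : numq y * d%:Z = n * denq y.
  by apply: (@intr_inj rat); rewrite !rmorphM /= numqE mulrAC -pmulrn divfK.
move/(congr1 absz); rewrite !abszM absz_nat => e.
apply: coprime_dvdr cd.
have := coprime_num_den y; rewrite coprime_sym => /Gauss_dvdr <-.
by rewrite e dvdn_mull.
Qed.

Fact pint_subring p : subring_closed (pint p).
Proof.
split.
- by apply/pintP; exists 1, 1%N; rewrite coprimen1.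
- move=> _ _ /pintP[n [d [cd [d0 ->]]]] /pintP[n' [d' [cd' [d0' ->]]]].
  apply/pintP; exists (n * d'%:Z - n' * d%:Z), (d * d')%N.
  rewrite coprimeMr cd cd' muln_gt0 d0 d0'; split=> //; split=> //.
  have h : d%:R != 0 :> rat by rewrite pnatr_eq0 -lt0n.
  have h' : d'%:R != 0 :> rat by rewrite pnatr_eq0 -lt0n.
  by rewrite rmorphB !rmorphM /= -?pmulrn ?natrM; field; rewrite h h'.
- move=> _ _ /pintP[n [d [cd [d0 ->]]]] /pintP[n' [d' [cd' [d0' ->]]]].
  apply/pintP; exists (n * n'), (d * d')%N.
  rewrite coprimeMr cd cd' muln_gt0 d0 d0'; split=> //; split=> //.
  by rewrite rmorphM /= ?natrM mulf_div.
Qed.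
HB.instance Definition _ p := GRing.isSubringClosed.Build rat (pint_pred p) (pint_subring p).

Lemma pint_inv p n : coprime p n -> (0 < n)%N -> n%:R^-1 \is a pint p.
Proof. by move=> cn n0; apply/pintP; exists 1, n; rewrite mul1r. Qed.

Lemma pint_cancel p n x : coprime p n -> (0 < n)%N ->
  n%:R * x \is a pint p -> x \is a pint p.
Proof.
move=> cn n0 h; have n1 : n%:R != 0 :> rat by rewrite pnatr_eq0 -lt0n.
by rewrite -(mulKf n1 x) rpredM // pint_inv.
Qed.

Lemma pint_natp p n : prime p -> (n%:R / p%:R \is a pint p) = (p %| n)%N.
Proof.
move=> pp; have p0 : p%:R != 0 :> rat by rewrite pnatr_eq0 -lt0n prime_gt0.
apply/idP/idP => [/pintP[z [d [cd [d0]]]]|/dvdnP[q ->]]; last first.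
  by rewrite natrM mulfK // rpred_nat.
have d1 : d%:R != 0 :> rat by rewrite pnatr_eq0 -lt0n.
move/eqP; rewrite eqr_div // => /eqP h.
have : (n * d)%:Z = z * p%:Z.
  by apply: (@intr_inj rat); rewrite [RHS]intrM -!pmulrn -h natrM.
move/(congr1 absz); rewrite absz_nat abszM absz_nat => e.
by rewrite -(Gauss_dvdl _ cd) e dvdn_mull.
Qed.

(** The size of n bounds its p-adic order by s. *)
Lemma pint_pow_div p s n : prime p -> (0 < n)%N -> (n < p ^ s.+1)%N ->
  p%:R ^+ s / n%:R \is a pint p.
Proof.
move=> pp n0 nlt; have [u cu e] := pfactor_coprime pp n0.
have u0 : (0 < u)%N by move: n0; rewrite {1}e muln_gt0 => /andP[].
have vs : (logn p n <= s)%N.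
  rewrite -ltnS -(ltn_exp2l _ _ (prime_gt1 pp)); apply: leq_ltn_trans nlt.
  by rewrite dvdn_leq // pfactor_dvdnn.
have p0 : p%:R != 0 :> rat by rewrite pnatr_eq0 -lt0n prime_gt0.
have u1 : u%:R != 0 :> rat by rewrite pnatr_eq0 -lt0n.
have -> : p%:R ^+ s / n%:R = p%:R ^+ (s - logn p n) * u%:R^-1 :> rat.
  by rewrite {1}e natrM natrX -{1}(subnK vs) exprD; field; rewrite u1 expf_neq0.
by rewrite rpredM ?pint_inv // rpredX ?rpred_nat.
Qed.

Lemma leq_exp3 i : (0 < i)%N -> (i.+1 < 3 ^ i)%N.
Proof. by elim: i => // -[//|i] IH _; rewrite expnS; have := IH isT; lia. Qed.

(** P_n(p) is an integer with first term p B_n. The other terms are integer multiples of p B_(n-j)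
    p^j / (j+1) with j > 0, integral by induction and j+1 < p^(j+1). *)
Lemma von_staudt_int B (hB : bernoulli_recurrence B) p n : prime p ->
  p%:R * B n \is a pint p.
Proof.
move=> pp; elim/ltn_ind: n => n IH.
have := sum_powers hB n p; rewrite /faulhaber big_ord_recl /= bin0 subn0 divr1 mul1r mulrC.
move=> /esym/(canRL (addrK _)) ->; rewrite rpredB ?rpred_nat // rpred_sum // => i _.
rewrite /bump /= add1n exprS.
have -> : 'C(n, i.+1)%:R * B (n - i.+1)%N * (p%:R * p%:R ^+ i.+1) / i.+2%:R
   = 'C(n, i.+1)%:R * (p%:R * B (n - i.+1)%N) * (p%:R ^+ i.+1 / i.+2%:R) by ring.
apply: rpredM.
  by apply: rpredM; [exact: rpred_nat | apply: IH; have := ltn_ord i; lia].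
apply: pint_pow_div => //; apply: ltn_expl; exact: prime_gt1.
Qed.

(** The same expansion divided by p: now p^(j-1) / (j+1) has to be integral, and j+1 < p^j holds for
    j > 0 since p is at least 3. *)
Lemma von_staudt_mod B (hB : bernoulli_recurrence B) p n : prime p -> (2 < p)%N ->
  (p%:R * B n - (\sum_(j < p) j ^ n)%N%:R) / p%:R \is a pint p.
Proof.
move=> pp p2.
have p0 : p%:R != 0 :> rat by rewrite pnatr_eq0 -lt0n prime_gt0.
rewrite (sum_powers hB n p) /faulhaber big_ord_recl /= bin0 subn0 divr1 mul1r.
rewrite [B n * _]mulrC opprD addNKr mulNr rpredN mulr_suml rpred_sum // => i _.
rewrite /bump /= add1n !exprS.
have -> : 'C(n, i.+1)%:R * B (n - i.+1)%N * (p%:R * (p%:R * p%:R ^+ i)) / i.+2%:R / p%:R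
   = 'C(n, i.+1)%:R * (p%:R * B (n - i.+1)%N) * (p%:R ^+ i / i.+2%:R).
  by field; rewrite p0 -natrD pnatr_eq0.
apply: rpredM.
  by apply: rpredM; [exact: rpred_nat | exact: von_staudt_int].
apply: pint_pow_div => //; apply: (leq_trans (leq_exp3 (ltn0Sn i))).
by rewrite leq_exp2r.
Qed.

(** * Residues and power sums modulo p *)

Lemma sum_mulmod (V : nmodType) (F : nat -> V) a N : (0 < N)%N -> coprime a N ->
  \sum_(j < N) F (a * j %% N)%N = \sum_(j < N) F j.
Proof.
move=> N0 co; pose h (j : 'I_N) := Ordinal (ltn_pmod (a * j) N0).
rewrite [RHS](reindex_inj (h := h)) // => i j /(congr1 val) /= /eqP e.
apply: val_inj => /=; wlog ij : i j e / (i <= j)%N.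
  by case: (leqP i j) => [ij|/ltnW ji] H; [exact: H | symmetry; apply: H; rewrite // eq_sym].
move: e; rewrite eq_sym eqn_mod_dvd ?leq_mul2l ?ij ?orbT // -mulnBr.
rewrite Gauss_dvdr; last by rewrite coprime_sym.
have := ltn_ord j; case: (posnP (j - i)%N) => [? _ _|d0 jN]; first lia.
move/(dvdn_leq d0); lia.
Qed.

(** Fermat in the form x^p = x, which includes x divisible by p, trades one factor x for p of them;
    this needs a positive exponent. *)
Lemma exp_mod_period p x s t : prime p -> (0 < s)%N -> (0 < t)%N ->
  (s = t %[mod p - 1])%N -> (x ^ s = x ^ t %[mod p])%N.
Proof.
move=> pp; wlog st : s t / (s <= t)%N.
  by case: (leqP s t) => [?|/ltnW ?] H *; [apply: H | symmetry; apply: H].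
move=> s0 _ /esym/eqP; rewrite eqn_mod_dvd // => /dvdnP[u e].
have -> : t = (s + u * (p - 1))%N by rewrite -e subnKC.
elim: u {e} => [|u IH]; first by rewrite addn0.
rewrite IH mulSn; move: (u * (p - 1))%N => w.
have -> : (s + (p - 1 + w) = (s + w).-1 + p)%N by have := prime_gt0 pp; lia.
have {1}-> : (s + w = (s + w).-1 + 1)%N by lia.
by rewrite !expnD -modnMmr -[RHS]modnMmr fermat_little // expn1.
Qed.

Lemma exists_nonroot p n : prime p -> ~~ (p - 1 %| n)%N ->
  exists g, [/\ (0 < g)%N, coprime p g & ~~ (p %| g ^ n - 1)%N].
Proof.
move=> pp np.
have p1 := prime_gt1 pp.
have chp : p \in [pchar 'F_p] by rewrite pchar_Fp.
(* The p-1 nonzero elements of the field are distinct (p-1)-th roots of unity, so one of them is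
   primitive; it serves as g. *)
pose rs := enum (predC1 (0 : 'F_p)).
have u (x : 'F_p) : (nat_of_ord x)%:R = x by rewrite natr_Zp.
have urs : all (p - 1).-unity_root rs.
  apply/allP => x; rewrite mem_enum unity_rootE => x0.
  have : x ^+ p = x.
    by rewrite -[x in LHS]u -natrX -Fp_nat_mod // fermat_little // Fp_nat_mod // u.
  have -> : x ^+ p = x ^+ (p - 1) * x by rewrite -exprSr; congr (_ ^+ _); lia.
  by move=> e; apply/eqP/(mulIf x0); rewrite e mul1r.
have /hasP[z _ zp] : has (p - 1).-primitive_root rs.
  apply: has_prim_root => //; rewrite ?enum_uniq ?subn_gt0 //.
  by rewrite -cardE cardC1 card_Fp // subn1.
have z0 : z != 0.
  apply/eqP => z0; have /eqP := prim_expr_order zp.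
  by rewrite z0 expr0n subn_eq0 leqNgt p1 eq_sym oner_eq0.
have zpos : (0 < nat_of_ord z)%N.
  by rewrite lt0n; apply: contra z0 => /eqP z0; apply/eqP/val_inj.
exists (nat_of_ord z); split=> //.
- by rewrite prime_coprime // (dvdn_pcharf chp) u.
- apply: contra np; rewrite (prim_order_dvd zp) (dvdn_pcharf chp) natrB.
    by rewrite natrX u subr_eq0.
  by rewrite expn_gt0 zpos.
Qed.

(** Multiplication by g permutes the residues, so (g^n - 1) times the sum vanishes mod p, and g^n -
    1 is a unit. *)
Lemma sum_pow_dvd p n : prime p -> ~~ (p - 1 %| n)%N -> (p %| \sum_(j < p) j ^ n)%N.
Proof.
move=> pp np; have [g [g0 cg h]] := exists_nonroot pp np.
rewrite -(Gauss_dvdr (n := g ^ n - 1)) ?prime_coprime //.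
rewrite mulnBl mul1n -eqn_mod_dvd; last by rewrite leq_pmull // expn_gt0 g0.
rewrite -[in X in _ == X %[mod _]](sum_mulmod (fun j => j ^ n)%N (prime_gt0 pp) (a := g)).
  rewrite big_distrr /= -modn_summ; apply/eqP; rewrite -[RHS]modn_summ; congr (_ %% _)%N.
  by apply: eq_bigr => j _; rewrite -expnMn modnXm.
by rewrite coprime_sym.
Qed.

(** Each of the p-1 nonzero residues contributes 1, and j = 0 contributes 0 since n > 0. *)
Lemma sum_pow_succ_dvd p n : prime p -> (0 < n)%N -> (p - 1 %| n)%N ->
  (p %| (\sum_(j < p) j ^ n).+1)%N.
Proof.
move=> pp n0 pn; case: p pp pn => // p pp; rewrite subSS subn0 => pn.
rewrite big_ord_recl /= exp0n // add0n -[X in (_ %| X)%N]addn1 /dvdn -modnDml -modn_summ.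
rewrite (eq_bigr (fun=> 1%N)).
  by rewrite sum_nat_const card_ord muln1 modnDml addn1 modnn.
move=> i _; rewrite /bump /= add1n.
have ci : coprime i.+1 p.+1.
  by rewrite coprime_sym prime_coprime // gtnNdvd // ltnS.
case/dvdnP: pn => q ->; rewrite mulnC expnM.
have := Euler_exp_totient ci; rewrite totient_prime //= => e.
by rewrite -modnXm e modnXm exp1n modn_small // prime_gt1.
Qed.

(** * Voronoi's and Kummer's congruences *)

(** The modulus p^2, rather than p, leaves each later Faulhaber term one factor p for the
    denominator of the Bernoulli number and one for the congruence. *)
Lemma power_sum_quot B (hB : bernoulli_recurrence B) p k : prime p -> (2 < p)%N ->
  ((\sum_(j < p ^ 2) j ^ k.+1)%N%:R / ((p ^ 2)%:R * k.+1%:R) - B k.+1 / k.+1%:R) / p%:R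
    \is a pint p.
Proof.
move=> pp p2; have p0 : p%:R != 0 :> rat by rewrite pnatr_eq0 -lt0n prime_gt0.
have k0 := natr_neq0 k.
rewrite (sum_powers hB) /faulhaber big_ord_recl /= bin0 subn0 divr1 mul1r expr1.
rewrite [(_ + _) / (_ * _)]mulrDl.
have -> : B k.+1 * (p ^ 2)%:R / ((p ^ 2)%:R * k.+1%:R) = B k.+1 / k.+1%:R :> rat.
  by rewrite natrX; field; rewrite p0 ?nat1r -?natrD !pnatr_eq0.
rewrite [B _ / _ + _]addrC addrK !mulr_suml rpred_sum // => i _.
rewrite /bump /= add1n subSS.
have i0 := natr_neq0 i; have i1 := natr_neq0 i.+1.
have e := bin_div_succ k i.
(* The factor k+1 is absorbed by C(k+1,i+1) / (k+1) = C(k,i) / (i+1), and 1 / ((i+1)(i+2)) is split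
   into partial fractions. *)
have -> : 'C(k.+1, i.+1)%:R * B (k - i)%N * (p ^ 2)%:R ^+ i.+2 / i.+2%:R /
    ((p ^ 2)%:R * k.+1%:R) / p%:R
  = 'C(k, i)%:R * (p%:R * B (k - i)%N)
     * (p%:R ^+ (2 * i) / i.+1%:R - p%:R ^+ (2 * i) / i.+2%:R) :> rat.
  have -> : 'C(k.+1, i.+1)%:R = 'C(k, i)%:R / i.+1%:R * k.+1%:R :> rat by rewrite e divfK.
  have -> : (p ^ 2)%:R ^+ i.+2 = p%:R ^+ (2 * i) * p%:R ^+ 4 :> rat.
    by rewrite natrX -exprM -exprD; congr (_ ^+ _); lia.
  by rewrite natrX; field; rewrite p0 ?nat1r -?natrD !pnatr_eq0.
have lt1 : (i.+2 < p ^ (2 * i).+1)%N.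
  have := leq_exp3 (ltn0Sn i) => h; apply: leq_trans h _.
  apply: (@leq_trans (p ^ i.+1)); first by rewrite leq_exp2r.
  by rewrite leq_exp2l ?prime_gt1 //; lia.
apply: rpredM; first by apply: rpredM; [exact: rpred_nat | exact: von_staudt_int].
by apply: rpredB; apply: pint_pow_div => //; apply: ltn_trans lt1.
Qed.

(** The linear term of the binomial expansion yields q r^k. In the others C(k+1,j) / (k+1) =
    C(k,j-1) / j, so a factor p in k+1 does no harm. *)
Lemma pow_div_expand p k q r : prime p -> (2 < p)%N ->
  (((r + q * p ^ 2)%N%:R ^+ k.+1 - r%:R ^+ k.+1) / ((p ^ 2)%:R * k.+1%:R) - q%:R * r%:R ^+ k)
    / p%:R \is a pint p.
Proof.
move=> pp p2; have p0 : p%:R != 0 :> rat by rewrite pnatr_eq0 -lt0n prime_gt0.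
have k0 := natr_neq0 k.
rewrite natrD exprDn big_ord_recl /= expr0 mulr1 bin0 mulr1n subn0 addrAC subrr add0r.
rewrite big_ord_recl /= bin1 /bump /= addn0 subn1 /= expr1 [(_ + _) / (_ * _)]mulrDl.
have -> : (r%:R ^+ k * (q * p ^ 2)%:R) *+ k.+1 / ((p ^ 2)%:R * k.+1%:R) = q%:R * r%:R ^+ k :> rat.
  by rewrite -mulr_natr natrM natrX; field; rewrite p0 ?nat1r -?natrD !pnatr_eq0.
rewrite addrAC subrr add0r !mulr_suml rpred_sum // => i _.
rewrite !add1n.
have -> : (r%:R ^+ (k.+1 - i.+2) * (q * p ^ 2)%:R ^+ i.+2) *+ 'C(k.+1, i.+2)
      / ((p ^ 2)%:R * k.+1%:R) / p%:R
  = 'C(k, i.+1)%:R * r%:R ^+ (k.+1 - i.+2) * q%:R ^+ i.+2 * (p%:R ^+ (2 * i).+1 / i.+2%:R) :> rat.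
  have e := bin_div_succ k i.+1; have i2 := natr_neq0 i.+1.
  rewrite -mulr_natr.
  have -> : 'C(k.+1, i.+2)%:R = 'C(k, i.+1)%:R / i.+2%:R * k.+1%:R :> rat by rewrite e divfK.
  have -> : (q * p ^ 2)%:R ^+ i.+2 = q%:R ^+ i.+2 * (p%:R ^+ (2 * i).+1 * p%:R ^+ 3) :> rat.
    by rewrite natrM exprMn natrX -exprM -exprD; congr (_ * _ ^+ _); lia.
  by rewrite natrX; field; rewrite p0 ?nat1r -?natrD !pnatr_eq0.
apply: rpredM.
  by apply: rpredM; [apply: rpredM; [|apply: rpredX]|apply: rpredX]; exact: rpred_nat.
apply: pint_pow_div => //; apply: (leq_trans (leq_exp3 (ltn0Sn i))).
apply: (@leq_trans (p ^ i.+1)); first by rewrite leq_exp2r.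
by rewrite leq_exp2l ?prime_gt1 //; lia.
Qed.

Definition voronoi_sum (p a k : nat) : nat :=
  (\sum_(j < p ^ 2) (a * j %/ p ^ 2) * (a * j %% p ^ 2) ^ k)%N.

(** Sum [pow_div_expand] over a j = q p^2 + r: the powers (a j)^(k+1) add up to a^(k+1) S, and the
    r^(k+1) to S because the residues are permuted. *)
Lemma voronoi B (hB : bernoulli_recurrence B) p a k : prime p -> (2 < p)%N ->
  coprime p a ->
  ((a%:R ^+ k.+1 - 1) * (B k.+1 / k.+1%:R) - (voronoi_sum p a k)%:R) / p%:R \is a pint p.
Proof.
move=> pp p2 ca; have p0 : p%:R != 0 :> rat by rewrite pnatr_eq0 -lt0n prime_gt0.
have N0 : (0 < p ^ 2)%N by rewrite expn_gt0 prime_gt0.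
have cN : coprime a (p ^ 2) by rewrite coprime_sym coprimeXl.
set S := (\sum_(j < p ^ 2) j ^ k.+1)%N.
have H : ((a%:R ^+ k.+1 - 1) * (S%:R / ((p ^ 2)%:R * k.+1%:R)) - (voronoi_sum p a k)%:R) / p%:R
    \is a pint p.
  have -> : ((a%:R ^+ k.+1 - 1) * (S%:R / ((p ^ 2)%:R * k.+1%:R)) - (voronoi_sum p a k)%:R) / p%:R
    = \sum_(j < p ^ 2) ((((a * j %% p ^ 2) + (a * j %/ p ^ 2) * p ^ 2)%N%:R ^+ k.+1
        - (a * j %% p ^ 2)%N%:R ^+ k.+1) / ((p ^ 2)%:R * k.+1%:R)
        - (a * j %/ p ^ 2)%N%:R * (a * j %% p ^ 2)%N%:R ^+ k) / p%:R :> rat.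
    rewrite -mulr_suml sumrB -mulr_suml sumrB.
    rewrite (sum_mulmod (fun i => i%:R ^+ k.+1 : rat)) //.
    congr ((_ - _) / _).
      rewrite mulrA; congr (_ / _); rewrite mulrBl mul1r; congr (_ - _).
        rewrite /S natr_sum mulr_sumr; apply: eq_bigr => j _.
        by rewrite addnC -divn_eq natrM exprMn natrX.
      by rewrite /S natr_sum; apply: eq_bigr => j _; rewrite natrX.
    by rewrite /voronoi_sum natr_sum; apply: eq_bigr => j _; rewrite natrM natrX.
  by apply: rpred_sum => j _; apply: pow_div_expand.
(* Trade the normalized power sum for B_(k+1) / (k+1) by [power_sum_quot]. *)
have -> : ((a%:R ^+ k.+1 - 1) * (B k.+1 / k.+1%:R) - (voronoi_sum p a k)%:R) / p%:R =
   ((a%:R ^+ k.+1 - 1) * (S%:R / ((p ^ 2)%:R * k.+1%:R)) - (voronoi_sum p a k)%:R) / p%:R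
   - (a%:R ^+ k.+1 - 1) * ((S%:R / ((p ^ 2)%:R * k.+1%:R) - B k.+1 / k.+1%:R) / p%:R) by ring.
apply: rpredB => //; apply: rpredM; last exact: power_sum_quot.
by apply: rpredB; [apply: rpredX; exact: rpred_nat | exact: rpred1].
Qed.

Lemma pint_modp p x y : prime p -> (x = y %[mod p])%N -> (x%:R - y%:R) / p%:R \is a pint p.
Proof.
move=> pp; have p0 : p%:R != 0 :> rat by rewrite pnatr_eq0 -lt0n prime_gt0.
move=> e; have -> : x%:R - y%:R = ((x %/ p)%:R - (y %/ p)%:R) * p%:R :> rat.
  by rewrite {1}(divn_eq x p) {1}(divn_eq y p) e !natrD !natrM; ring.
by rewrite mulfK // rpredB ?rpred_nat.
Qed.

Lemma voronoi_sum_mod p a s t : prime p -> (0 < s)%N -> (0 < t)%N ->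
  (s = t %[mod p - 1])%N -> (voronoi_sum p a s = voronoi_sum p a t %[mod p])%N.
Proof.
move=> pp s0 t0 e; rewrite /voronoi_sum -modn_summ -[RHS]modn_summ; congr (_ %% _)%N.
apply: eq_bigr => j _; rewrite -modnMmr -[RHS]modnMmr; congr (_ * _ %% _)%N.
exact: exp_mod_period.
Qed.

(** Voronoi gives (g^r - 1) B_r / r = (g^k - 1) B_k / k = 0 mod p with g^r - 1 a unit; multiplying
    by r clears its denominator. Indices above 1 keep the exponents k-1 and r-1 in the Voronoi sums
    positive, as [exp_mod_period] demands. *)
Lemma bernoulli_div_mod B (hB : bernoulli_recurrence B) p k r : prime p -> (2 < p)%N ->
  (1 < k)%N -> (1 < r)%N -> ~~ (p - 1 %| k)%N -> (k = r %[mod p - 1])%N ->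
  B k / k%:R / p%:R \is a pint p -> B r / p%:R \is a pint p.
Proof.
case: k r => [|k] [|r] // pp p2; rewrite !ltnS => k0 r0 nk kr hk.
have [g [g0 cg ng]] := exists_nonroot pp nk.
have p0 : p%:R != 0 :> rat by rewrite pnatr_eq0 -lt0n prime_gt0.
have kr' : (k = r %[mod p - 1])%N.
  by apply/eqP; rewrite -(eqn_modDl 1) !add1n; apply/eqP.
have er : (g ^ k.+1 = g ^ r.+1 %[mod p])%N by apply: exp_mod_period.
have v1 := voronoi hB k pp p2 cg; have v2 := voronoi hB r pp p2 cg.
have v3 := pint_modp pp (voronoi_sum_mod g pp k0 r0 kr').
have ng' : ~~ (p %| g ^ r.+1 - 1)%N.
  by move: ng; rewrite -!eqn_mod_dvd ?expn_gt0 ?g0 // er.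
have u0 : (0 < g ^ r.+1 - 1)%N by rewrite lt0n; apply: contra ng' => /eqP ->.
apply: (@pint_cancel _ (g ^ r.+1 - 1)) => //; first by rewrite prime_coprime.
have gk : (g%:R ^+ k.+1 - 1) * (B k.+1 / k.+1%:R / p%:R) \is a pint p.
  by apply: rpredM => //; apply: rpredB; [apply: rpredX; exact: rpred_nat | exact: rpred1].
have r1 := natr_neq0 r.
have -> : (g ^ r.+1 - 1)%:R * (B r.+1 / p%:R) = r.+1%:R * (
   ((g%:R ^+ r.+1 - 1) * (B r.+1 / r.+1%:R) - (voronoi_sum p g r)%:R) / p%:R
   - (((g%:R ^+ k.+1 - 1) * (B k.+1 / k.+1%:R) - (voronoi_sum p g k)%:R) / p%:R)
   - ((voronoi_sum p g k)%:R - (voronoi_sum p g r)%:R) / p%:R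
   + (g%:R ^+ k.+1 - 1) * (B k.+1 / k.+1%:R / p%:R)) :> rat.
  rewrite natrB ?expn_gt0 ?g0 // natrX.
  move: (voronoi_sum p g k) (voronoi_sum p g r) (B k.+1 / k.+1%:R) => u v w.
  by field; rewrite p0 nat1r.
apply: rpredM; first exact: rpred_nat.
by apply: rpredD => //; apply: rpredB => //; apply: rpredB.
Qed.

(** * The size of the quotient *)

Local Open Scope nat_scope.

Lemma T_succ k m : T k m.+1 = T k m + (2 * m + 1) ^ k.
Proof. by rewrite /T big_nat_recr //=; congr (_ + _ ^ _); lia. Qed.

Lemma T_ge k m : 0 < m -> (2 * m - 1) ^ k <= T k m.
Proof.
case: m => // m _; rewrite T_succ; have -> : 2 * m.+1 - 1 = 2 * m + 1 by lia.
exact: leq_addl.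
Qed.

(** The last summand of T_k(m) is (N-2)^k, and N / (N-2) is at most 5/3 for N >= 5. *)
Lemma quotient_bound a k m : 1 < m -> a * T k m = (2 * m + 1) ^ k -> a * 3 ^ k <= 5 ^ k.
Proof.
move=> m1 e; have d0 : 0 < (2 * m - 1) ^ k by rewrite expn_gt0; lia.
rewrite -(leq_pmul2r d0) -mulnA [3 ^ k * _]mulnC mulnA -expnMn.
apply: (@leq_trans (a * T k m * 3 ^ k)).
  by rewrite leq_mul2r leq_mul2l T_ge ?orbT //; lia.
rewrite e -!expnMn; case: k {d0 e} => // k.
by rewrite leq_exp2r //; lia.
Qed.

Lemma T2_closed_form m : 3 * T 2 m = m * (2 * m - 1) * (2 * m + 1).
Proof.
elim: m => [|m IH]; first by rewrite /T big_geq.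
rewrite T_succ mulnDr IH; have -> : 2 * m.+1 - 1 = 2 * m + 1 by lia.
by case: m {IH} => // m; rewrite (_ : 2 * m.+1 - 1 = 2 * m + 1); nia.
Qed.

(** The case k = 2 is out of reach of the size estimates below. The closed form leaves a m (2m-1) =
    3 (2m+1), hence m <= 3, and 6a = 15 and 15a = 21 are impossible. *)
Lemma T2_ndvd a m : 1 < m -> a * T 2 m <> (2 * m + 1) ^ 2.
Proof.
move=> m1 e.
have h : a * (m * (2 * m - 1)) = 3 * (2 * m + 1).
  apply/eqP; rewrite -(@eqn_pmul2r (2 * m + 1)); [apply/eqP | lia].
  by rewrite -mulnA -T2_closed_form mulnCA e; lia.
have a0 : 0 < a by case: a {e} h => // ; lia.
have m3 : m <= 3.
  rewrite leqNgt; apply/negP => m4.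
  have : m * (2 * m - 1) <= 3 * (2 * m + 1) by rewrite -h leq_pmull.
  by nia.
have [m2|m3'] : m = 2 \/ m = 3 by lia.
  by move: h; rewrite m2; lia.
by move: h; rewrite m3'; lia.
Qed.

(** The valuations force ord_p(a) >= k - 2 - v, while a <= (5/3)^k. The slack v is 0 in the first
    use and ord_p(k) in the second. *)
Lemma expn_le_of_logn_T_lt a k m p v : 0 < a -> 1 < m -> 3 < k -> prime p -> p %| 2 * m + 1 ->
  a * T k m = (2 * m + 1) ^ k -> logn p (T k m) < 3 * logn p (2 * m + 1) + v ->
  p ^ (k - 2) * 3 ^ k <= p ^ v * 5 ^ k.
Proof.
move=> a0 m1 k3 pp pN e lt.
have T0 : 0 < T k m by apply: leq_trans (T_ge _ _); rewrite ?expn_gt0 //; lia.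
have := congr1 (logn p) e; rewrite lognM // lognX => l.
have e0 : 0 < logn p (2 * m + 1) by rewrite logn_gt0 mem_primes pp pN addn1.
have h : k - 2 <= v + logn p a.
  move: l lt e0; move: (logn p _) (logn p _) (logn p _) => x y z l lt z0; nia.
have := quotient_bound m1 e.
have la : p ^ logn p a <= a by rewrite dvdn_leq // pfactor_dvdnn.
move=> b; apply: (@leq_trans (p ^ v * (a * 3 ^ k))); last by rewrite leq_mul2l b orbT.
rewrite mulnA leq_mul2r; apply/orP; right.
apply: (@leq_trans (p ^ (v + logn p a))); first by rewrite leq_exp2l // prime_gt1.
by rewrite expnD leq_mul2l la orbT.
Qed.

(** It starts with 625 < 729 at k = 4; then the sides grow by factors 5 and 9. *)
Lemma exp5_lt_exp3_exp3 k : 3 < k -> 5 ^ k < 3 ^ (k - 2) * 3 ^ k.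
Proof.
move=> k3; rewrite -(subnK k3); elim: (k - 4) => // j IH.
have -> : j.+1 + 4 - 2 = (j + 4 - 2).+1 by lia.
by rewrite addSn !expnS; move: IH; lia.
Qed.

Lemma lt_2exp3 k : 3 < k -> 25 * k < 2 * 3 ^ k.
Proof.
move=> k3; rewrite -(subnK k3); elim: (k - 4) => // j IH.
by rewrite addSn !expnS; move: IH; lia.
Qed.

Lemma logn_T_ge a k m p : 0 < a -> 1 < m -> 3 < k -> prime p -> p %| 2 * m + 1 ->
  a * T k m = (2 * m + 1) ^ k -> 3 * logn p (2 * m + 1) <= logn p (T k m).
Proof.
move=> a0 m1 k3 pp pN e; rewrite leqNgt; apply/negP => lt.
have p3 : 2 < p.
  rewrite ltn_neqAle prime_gt1 // andbT; apply/eqP => p2; move: pN; rewrite -p2; lia.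
have := @expn_le_of_logn_T_lt a k m p 0 a0 m1 k3 pp pN e; rewrite addn0 => /(_ lt).
rewrite mul1n leqNgt => /negP; apply.
apply: leq_trans (exp5_lt_exp3_exp3 k3) _; rewrite leq_mul2r leq_exp2r ?p3 ?orbT //; lia.
Qed.

(** For p >= 5 a failure would give 3^k <= 25 p^(ord_p k). As k is even and p odd, 2 p^(ord_p k)
    divides k, so 2 * 3^k <= 25 k, against [lt_2exp3]. *)
Lemma logn_T_ge_strong a k m p : 0 < a -> 1 < m -> 3 < k -> ~~ odd k ->
  prime p -> 4 < p -> p %| 2 * m + 1 ->
  a * T k m = (2 * m + 1) ^ k ->
  3 * logn p (2 * m + 1) + logn p k <= logn p (T k m).
Proof.
move=> a0 m1 k3 ek pp p5 pN e; rewrite leqNgt; apply/negP => lt.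
have := expn_le_of_logn_T_lt a0 m1 k3 pp pN e lt.
have h1 : 5 ^ (k - 2) * 3 ^ k <= p ^ (k - 2) * 3 ^ k.
  by rewrite leq_mul2r leq_exp2r ?p5 ?orbT //; lia.
move/(leq_trans h1); have -> : 5 ^ k = 5 ^ (k - 2) * 25.
  by rewrite -[25]/(5 ^ 2) -expnD subnK //; lia.
rewrite mulnCA leq_pmul2l ?expn_gt0 // => h2.
have : 2 * p ^ logn p k <= k.
  apply: dvdn_leq; first lia.
  rewrite Gauss_dvd ?dvdn2 ?ek ?pfactor_dvdnn // coprimeXr // coprime2n.
  by case: (even_prime pp) => // p2; move: p5; rewrite p2.
have := lt_2exp3 k3; lia.
Qed.

Local Open Scope ring_scope.

(** * Divisibility of Bernoulli numbers *)

(** Here the even exponent is k+1. Absorbing it into the binomials leaves no factor k+1 in the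
    denominators of the sum. *)
Lemma T_expand B (hB : bernoulli_recurrence B)
    (hodd : forall n, odd n -> n != 1%N -> B n = 0) k m : odd k ->
  (T k.+1 m)%:R / (k.+1%:R * (2 * m + 1)%:R) =
    2%:R ^+ k * (B k.+1 / k.+1%:R)
    + \sum_(i < k.+1) 'C(k, i)%:R * B (k - i)%N * (2 * m + 1)%:R ^+ i.+1
        * (2%:R ^+ k / 2%:R ^+ i.+1) * (i.+1%:R^-1 - i.+2%:R^-1).
Proof.
move=> ok; rewrite (T_faulhaber hB hodd) //; last by rewrite /= ok.
have : (2 * m + 1)%:R != 0 :> rat by rewrite pnatr_eq0 addn1.
move: (2 * m + 1)%:R => N N0; have k0 := natr_neq0 k.
rewrite /faulhaber big_ord_recl /= bin0 subn0 divr1 mul1r expr1 mulrDr mulrDl; congr (_ + _).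
  by rewrite exprS; field; rewrite N0 nat1r natr_neq0.
rewrite mulr_sumr mulr_suml; apply: eq_bigr => i _; rewrite /bump /= add1n subSS.
have e := bin_div_succ k i; have i1 := natr_neq0 i; have i2 := natr_neq0 i.+1.
have -> : 'C(k.+1, i.+1)%:R = 'C(k, i)%:R / i.+1%:R * k.+1%:R :> rat by rewrite e divfK.
have t0 : 2%:R ^+ i != 0 :> rat by rewrite expf_neq0.
rewrite expr_div_n !exprS; field.
by rewrite N0 t0 ?nat1r -?natrD !pnatr_eq0.
Qed.

Lemma bernoulli_pint B (hB : bernoulli_recurrence B) p n : prime p -> (2 < p)%N ->
  ~~ (p - 1 %| n)%N -> B n \is a pint p.
Proof.
move=> pp p2 np; have p0 : p%:R != 0 :> rat by rewrite pnatr_eq0 -lt0n prime_gt0.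
have := von_staudt_mod hB n pp p2; have := sum_pow_dvd pp np.
rewrite -pint_natp // => h1 h2.
by have := rpredD h2 h1; rewrite -mulrDl subrK mulrC mulKf.
Qed.

Lemma bernoulli_nonint B (hB : bernoulli_recurrence B) p n : prime p -> (2 < p)%N ->
  (0 < n)%N -> (p - 1 %| n)%N -> B n \isn't a pint p.
Proof.
move=> pp p2 n0 np; have p0 : p%:R != 0 :> rat by rewrite pnatr_eq0 -lt0n prime_gt0.
apply/negP => h.
have := von_staudt_mod hB n pp p2; have := sum_pow_succ_dvd pp n0 np.
rewrite mulrBl [_ * B n]mulrC mulfK // => h1 h2.
have : (\sum_(j < p) j ^ n)%N%:R / p%:R \is a pint p.
  by have := rpredB h h2; rewrite opprB addrC subrK.
rewrite pint_natp // => h3; move: h1; rewrite -addn1 dvdn_addr // dvdn1 => /eqP p1.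
by rewrite p1 in p2.
Qed.

(** Since 3 - 1 divides n, the prime 3 occurs in the denominator of B_n. *)
Lemma bernoulli_neq0 B (hB : bernoulli_recurrence B) n : ~~ odd n -> (0 < n)%N -> B n != 0.
Proof.
move=> en n0; apply/eqP => b0.
have n2 : (3 - 1 %| n)%N by rewrite dvdn2.
by have := bernoulli_nonint hB (isT : prime 3) isT n0 n2; rewrite b0 rpred0.
Qed.

Lemma leq_exp5 i : (0 < i)%N -> (i + 3 < 5 ^ i)%N.
Proof. by elim: i => // -[//|i] IH _; rewrite expnS; have := IH isT; lia. Qed.

Ltac eval_bin := repeat match goal with
  |- context [binomial ?n ?j] =>
    let v := eval vm_compute in (binomial n j) in
    rewrite (_ : binomial n j = v); last by vm_compute
  end.

Lemma bernoulli_upto12 B (hB : bernoulli_recurrence B)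
    (hodd : forall n, odd n -> n != 1%N -> B n = 0) :
  [/\ B 0%N = 1, B 1%N = - 1 / 2%:R, B 2 = 1 / 6%:R & B 4 = - 1 / 30%:R] /\
  [/\ B 6 = 1 / 42%:R, B 8 = - 1 / 30%:R, B 10 = 5%:R / 66%:R & B 12 = - 691%:R / 2730%:R].
Proof.
have o3 := hodd 3 isT isT; have o5 := hodd 5 isT isT; have o7 := hodd 7 isT isT.
have o9 := hodd 9 isT isT; have o11 := hodd 11 isT isT.
have h n : \sum_(0 <= j < n.+1) 'C(n.+1, j)%:R * B j = (n == 0%N)%:R.
  by rewrite big_mkord hB eqSS.
have b0 : B 0%N = 1 by have := h 0%N; rewrite unlock /=; eval_bin; lra.
have b1 : B 1%N = -1 / 2%:R.
  by have := h 1%N; rewrite unlock /= b0; eval_bin; lra.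
have b2 : B 2 = 1 / 6%:R.
  by have := h 2; rewrite unlock /= b0 b1; eval_bin; lra.
have b4 : B 4 = - 1 / 30%:R.
  by have := h 4; rewrite unlock /= b0 b1 b2 o3; eval_bin; lra.
have b6 : B 6 = 1 / 42%:R.
  by have := h 6; rewrite unlock /= b0 b1 b2 o3 b4 o5; eval_bin; lra.
have b8 : B 8 = - 1 / 30%:R.
  by have := h 8; rewrite unlock /= b0 b1 b2 o3 b4 o5 b6 o7; eval_bin; lra.
have b10 : B 10 = 5%:R / 66%:R.
  by have := h 10; rewrite unlock /= b0 b1 b2 o3 b4 o5 b6 o7 b8 o9; eval_bin; lra.
have b12 : B 12 = - 691%:R / 2730%:R.
  by have := h 12; rewrite unlock /= b0 b1 b2 o3 b4 o5 b6 o7 b8 o9 b10 o11; eval_bin; lra.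
(* [done] would head-normalise the rational equations of the context. *)
exact (conj (And4 b0 b1 b2 b4) (And4 b6 b8 b10 b12)).
Qed.

(* Factored because large [nat] literals are unary. *)
Lemma bin15 : [/\ 'C(15, 2) = 15 * 7, 'C(15, 4) = 35 * 39, 'C(15, 6) = 55 * 91 &
  'C(15, 8) = 65 * 99]%N /\ ('C(15, 10) = 39 * 77 /\ 'C(15, 12) = 13 * 35)%N.
Proof. by do 2 split; apply/eqP; vm_compute. Qed.

Lemma bernoulli14 B (hB : bernoulli_recurrence B)
    (hodd : forall n, odd n -> n != 1%N -> B n = 0) : B 14 = 7%:R / 6%:R.
Proof.
have [[b0 b1 b2 b4] [b6 b8 b10 b12]] := bernoulli_upto12 hB hodd.
have [[c2 c4 c6 c8] [c10 c12]] := bin15.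
have o3 := hodd 3 isT isT; have o5 := hodd 5 isT isT; have o7 := hodd 7 isT isT.
have o9 := hodd 9 isT isT; have o11 := hodd 11 isT isT; have o13 := hodd 13 isT isT.
have : \sum_(0 <= j < 15) 'C(15, j)%:R * B j = 0 by rewrite big_mkord hB.
rewrite unlock /= b0 b1 b2 o3 b4 o5 b6 o7 b8 o9 b10 o11 b12 o13.
by rewrite bin0 bin1 binSn c2 c4 c6 c8 c10 c12 !natrM; lra.
Qed.

(** * p-adic estimates for the terms of the expansion *)

Lemma pint_pow2 p a b : odd p -> 2%:R ^+ a / 2%:R ^+ b \is a pint p.
Proof.
move=> op; apply: rpredM; first by apply: rpredX; exact: rpred_nat.
by rewrite -natrX pint_inv ?expn_gt0 // coprimeXr // coprimen2.
Qed.

Lemma pint_div_logn p t n : prime p -> (0 < n)%N -> (0 < t)%N ->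
  (logn p n <= logn p t)%N -> t%:R / n%:R \is a pint p.
Proof.
move=> pp n0 t0 le; have [u cu e] := pfactor_coprime pp n0.
have [w _ e'] := pfactor_coprime pp t0.
have u0 : (0 < u)%N by move: n0; rewrite {1}e muln_gt0 => /andP[].
have u1 : u%:R != 0 :> rat by rewrite pnatr_eq0 -lt0n.
have p0 : p%:R != 0 :> rat by rewrite pnatr_eq0 -lt0n prime_gt0.
have -> : t%:R / n%:R = w%:R * p%:R ^+ (logn p t - logn p n) * u%:R^-1 :> rat.
  rewrite {1}e' {1}e !natrM !natrX -{1}(subnK le) exprD; field.
  by rewrite u1 expf_neq0.
apply: rpredM; last exact: pint_inv.
by apply: rpredM; [|apply: rpredX]; exact: rpred_nat.
Qed.

(** Cross-multiply x = p^s y and compare orders; the denominator of y contributes none. *)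
Lemma padic_ord_ge p (s : nat) (x : rat) : prime p -> x != 0 -> x / p%:R ^+ s \is a pint p ->
  s%:Z <= padic_ord p x.
Proof.
move=> pp x0; set y := x / _ => hy.
have p0 : p%:R != 0 :> rat by rewrite pnatr_eq0 -lt0n prime_gt0.
have xy : x = p%:R ^+ s * y by rewrite mulrC divfK // expf_neq0.
have y0 : y != 0 by apply: contra x0 => /eqP y0; rewrite xy y0 mulr0.
have : numq x * denq y = (p ^ s)%:Z * numq y * denq x.
  apply: (@intr_inj rat); rewrite !intrM !numqE -pmulrn natrX {1}xy; ring.
move/(congr1 absz); rewrite !abszM absz_nat => /(congr1 (logn p)).
have dy : logn p `|denq y| = 0%N by apply: logn_coprime; exact: hy.
rewrite !lognM ?muln_gt0 ?expn_gt0 ?(prime_gt0 pp) ?absz_gt0 ?numq_eq0 ?denq_neq0 //.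
rewrite dy pfactorK // /padic_ord; lia.
Qed.

Lemma padic_ord_nat p n : padic_ord p n%:R = logn p n.
Proof. by rewrite /padic_ord pmulrn numq_int denq_int logn1 subr0. Qed.

(** A crude estimate valid for p = 3 as well, used to show that p-1 does not divide the exponent.
    With N = p u, each later term has one p for the Bernoulli number and p^i for the denominator
    i+2. *)
Lemma bernoulli_pint_of_T B (hB : bernoulli_recurrence B)
    (hodd : forall n, odd n -> n != 1%N -> B n = 0) p k m : odd k ->
  prime p -> (2 < p)%N -> (p %| 2 * m + 1)%N ->
  (T k.+1 m)%:R / (2 * m + 1)%:R \is a pint p -> B k.+1 \is a pint p.
Proof.
move=> ok pp p2 /dvdnP[u eN] hT.
have op : odd p by case: (even_prime pp) => // p2'; rewrite p2' in p2.
have p0 : p%:R != 0 :> rat by rewrite pnatr_eq0 -lt0n prime_gt0.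
apply: (@pint_cancel _ (2 ^ k)); rewrite ?expn_gt0 ?coprimeXr ?coprimen2 //.
have k0 := natr_neq0 k.
have N0 : (2 * m + 1)%:R != 0 :> rat by rewrite pnatr_eq0 addn1.
have := T_expand hB hodd m ok; set s := \sum_(_ < _) _ => E.
have -> : (2 ^ k)%:R * B k.+1 = (T k.+1 m)%:R / (2 * m + 1)%:R - k.+1%:R * s.
  have -> : (T k.+1 m)%:R / (2 * m + 1)%:R
      = k.+1%:R * ((T k.+1 m)%:R / (k.+1%:R * (2 * m + 1)%:R)) :> rat.
    by move: N0; move: (2 * m + 1)%:R => N N0; field; rewrite N0 nat1r.
  by rewrite E natrX; move: s {E} => s; field; rewrite nat1r.
apply: rpredB => //; rewrite /s mulr_sumr; apply: rpred_sum => i _.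
have e := bin_div_succ k i; have i1 := natr_neq0 i; have i2 := natr_neq0 i.+1.
have -> : k.+1%:R * ('C(k, i)%:R * B (k - i)%N * (2 * m + 1)%:R ^+ i.+1
        * (2%:R ^+ k / 2%:R ^+ i.+1) * (i.+1%:R^-1 - i.+2%:R^-1))
  = 'C(k.+1, i.+1)%:R * (p%:R * B (k - i)%N) * (2%:R ^+ k / 2%:R ^+ i.+1)
    * u%:R ^+ i.+1 * (p%:R ^+ i / i.+2%:R) :> rat.
  have -> : 'C(k.+1, i.+1)%:R = 'C(k, i)%:R / i.+1%:R * k.+1%:R :> rat by rewrite e divfK.
  rewrite eN natrM exprMn; move: (_ / 2%:R ^+ _) => w.
  by rewrite [p%:R ^+ i.+1]exprS; field; rewrite ?nat1r -?natrD !pnatr_eq0.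
apply: rpredM.
  apply: rpredM; last by apply: rpredX; exact: rpred_nat.
  apply: rpredM; last exact: pint_pow2.
  by apply: rpredM; [exact: rpred_nat | exact: von_staudt_int].
apply: pint_pow_div => //; case: (nat_of_ord i) => [|j]; first by rewrite expn1.
apply: leq_trans (leq_exp3 (ltn0Sn j.+1)) _; first by rewrite leq_exp2r.
Qed.

(** The i-th summand in [T_expand]. Below N = p w u, where p w will be the p-part of N. *)
Definition T_term (B : nat -> rat) (N : rat) (k i : nat) : rat :=
  'C(k, i)%:R * B (k - i)%N * N ^+ i.+1 * (2%:R ^+ k / 2%:R ^+ i.+1)
    * (i.+1%:R^-1 - i.+2%:R^-1).

(** After division by (p w)^2 and one p spent on the Bernoulli number, p^(i-2) remains against i+1
    and i+2. The bound i+2 < p^(i-1) is tight at i = 2, where it reads 4 < p. *)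
Lemma T_term_high B (hB : bernoulli_recurrence B) p w u k i :
  prime p -> (4 < p)%N -> (0 < w)%N -> (1 < i)%N ->
  T_term B (p * w * u)%:R k i / (p * w)%:R ^+ 2 \is a pint p.
Proof.
case: i => [|[|i]] // pp p5 w0 _; rewrite /T_term.
have op : odd p by case: (even_prime pp) p5 => // ->.
have p0 : p%:R != 0 :> rat by rewrite pnatr_eq0 -lt0n prime_gt0.
have w1 : w%:R != 0 :> rat by rewrite pnatr_eq0 -lt0n.
have -> : 'C(k, i.+2)%:R * B (k - i.+2)%N * (p * w * u)%:R ^+ i.+3
        * (2%:R ^+ k / 2%:R ^+ i.+3) * (i.+3%:R^-1 - i.+4%:R^-1) / (p * w)%:R ^+ 2
  = 'C(k, i.+2)%:R * (p%:R * B (k - i.+2)%N) * (2%:R ^+ k / 2%:R ^+ i.+3)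
     * (u%:R ^+ i.+3 * w%:R ^+ i.+1) * (p%:R ^+ i / i.+3%:R - p%:R ^+ i / i.+4%:R) :> rat.
  rewrite !natrM !exprMn; move: (_ / 2%:R ^+ _) => z.
  have -> : p%:R ^+ i.+3 = p%:R ^+ i * p%:R ^+ 3 :> rat by rewrite -exprD addn3.
  have -> : w%:R ^+ i.+3 = w%:R ^+ i.+1 * w%:R ^+ 2 :> rat by rewrite -exprD addn2.
  by field; rewrite p0 w1 -?natrD !pnatr_eq0.
have h : (i.+4 < p ^ i.+1)%N.
  apply: (@leq_trans (5 ^ i.+1)); last by rewrite leq_exp2r.
  by have := leq_exp5 (ltn0Sn i); rewrite addn3.
apply: rpredM; last by apply: rpredB; apply: pint_pow_div => //; apply: ltn_trans h.
apply: rpredM; last by apply: rpredM; apply: rpredX; exact: rpred_nat.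
apply: rpredM; last exact: pint_pow2.
by apply: rpredM; [exact: rpred_nat | exact: von_staudt_int].
Qed.

(** For i = 1 the factor (p w)^2 is used up entirely, so nothing is left for the denominator of the
    Bernoulli number; x has to supply it. *)
Lemma T_term1 B p w u k (x : rat) : prime p -> (4 < p)%N -> (0 < w)%N ->
  x * B (k - 1)%N \is a pint p -> x * (T_term B (p * w * u)%:R k 1 / (p * w)%:R ^+ 2) \is a pint p.
Proof.
move=> pp p5 w0 hB.
have op : odd p by case: (even_prime pp) p5 => // ->.
have p0 : p%:R != 0 :> rat by rewrite pnatr_eq0 -lt0n prime_gt0.
have w1 : w%:R != 0 :> rat by rewrite pnatr_eq0 -lt0n.
have -> : x * (T_term B (p * w * u)%:R k 1 / (p * w)%:R ^+ 2)
  = 'C(k, 1)%:R * (x * B (k - 1)%N) * (2%:R ^+ k / 2%:R ^+ 2) * u%:R ^+ 2 * (2%:R^-1 - 3%:R^-1).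
  rewrite /T_term !natrM !exprMn; move: (_ / 2%:R ^+ _) => z.
  by field; rewrite p0 w1.
apply: rpredM; last first.
  by apply: rpredB; apply: pint_inv => //; rewrite prime_coprime // gtnNdvd //; apply: ltn_trans p5.
apply: rpredM; last by apply: rpredX; exact: rpred_nat.
apply: rpredM; last exact: pint_pow2.
by apply: rpredM; first exact: rpred_nat.
Qed.

(** It is applied twice: with x = p, where von Staudt handles B_(k-1), and with x = 1 once B_(k-1)
    is known to be p-integral. *)
Lemma bernoulli_bound B (hB : bernoulli_recurrence B)
    (hodd : forall n, odd n -> n != 1%N -> B n = 0) p w u k m (x : rat) :
  odd k -> (1 < k)%N -> prime p -> (4 < p)%N -> (0 < w)%N ->
  (2 * m + 1 = p * w * u)%N ->
  (T k.+1 m)%:R / (k.+1%:R * (2 * m + 1)%:R) / (p * w)%:R ^+ 2 \is a pint p ->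
  x \is a pint p -> x * B (k - 1)%N \is a pint p ->
  x * (B k.+1 / k.+1%:R / (p * w)%:R ^+ 2) \is a pint p.
Proof.
case: k => [|[|k]] // ok _ pp p5 w0 eN hT hx hxB.
have op : odd p by case: (even_prime pp) p5 => // ->.
apply: (@pint_cancel _ (2 ^ k.+2)); rewrite ?expn_gt0 ?coprimeXr ?coprimen2 //.
have := T_expand hB hodd m ok; rewrite eN.
rewrite (eq_bigr (fun i : 'I_k.+3 => T_term B (p * w * u)%:R k.+2 i)) //.
(* The term i = 0 carries a Bernoulli number of odd index at least 3 and vanishes. *)
rewrite big_ord_recl /= {1}/T_term subn0 (hodd k.+2) // mulr0 !mul0r add0r.
rewrite big_ord_recl /=.
set s := \sum_(_ < _) _; rewrite -eN => E.
have -> : (2 ^ k.+2)%:R * (x * (B k.+3 / k.+3%:R / (p * w)%:R ^+ 2)) =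
   x * ((T k.+3 m)%:R / (k.+3%:R * (2 * m + 1)%:R) / (p * w)%:R ^+ 2)
   - x * (T_term B (2 * m + 1)%:R k.+2 1 / (p * w)%:R ^+ 2)
   - x * (s / (p * w)%:R ^+ 2).
  rewrite E natrX.
  by move: (B k.+3 / _) (T_term _ _ _ _) s {E} ((p * w)%:R ^+ 2)^-1 => b t s q; ring.
apply: rpredB; first apply: rpredB.
- exact: rpredM.
- by rewrite eN; apply: T_term1.
- apply: rpredM => //; rewrite mulr_suml; apply: rpred_sum => i _; exact: T_term_high.
Qed.

(** * Numerators of small Bernoulli numbers *)

Lemma small_num_nondivp p (x : rat) (n d : nat) : prime p -> (0 < n < p)%N ->
  d%:R * x = n%:R \/ d%:R * x = - n%:R -> x / p%:R \isn't a pint p.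
Proof.
move=> pp /andP[n0 np] e; apply/negP => h.
have : n%:R / p%:R \is a pint p.
  have : d%:R * (x / p%:R) \is a pint p by apply: rpredM => //; exact: rpred_nat.
  by rewrite mulrA; case: e => ->; rewrite // mulNr rpredN.
by rewrite pint_natp // gtnNdvd.
Qed.

Lemma bernoulli24_nondivp B (hB : bernoulli_recurrence B)
    (hodd : forall n, odd n -> n != 1%N -> B n = 0) p r : prime p ->
  r \in [:: 2; 4] -> B r / p%:R \isn't a pint p.
Proof.
move=> pp; have h := prime_gt1 pp.
have [[b0 _ b2 b4] _] := bernoulli_upto12 hB hodd.
rewrite !inE => /orP[] /eqP ->.
- apply: (@small_num_nondivp _ _ 1%N 6 pp h); rewrite b2; left; lra.
- apply: (@small_num_nondivp _ _ 1%N 30 pp h); rewrite b4; right; lra.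
Qed.

(** The numerators in question are 1, 5 and 7 up to sign. The index 12 is missing because B_12 has
    numerator -691. *)
Lemma bernoulli_listed_nondivp B (hB : bernoulli_recurrence B)
    (hodd : forall n, odd n -> n != 1%N -> B n = 0) p c : prime p -> (10 < p)%N ->
  c \in [:: 0; 2; 4; 6; 8; 10; 14]%N -> B c / p%:R \isn't a pint p.
Proof.
move=> pp p11.
have h n : (0 < n < 11)%N -> (0 < n < p)%N.
  by case/andP=> -> /= n11; apply: leq_trans p11.
have [[b0 _ b2 b4] [b6 b8 b10 _]] := bernoulli_upto12 hB hodd.
have b14 := bernoulli14 hB hodd.
rewrite !inE => /or4P[|||/or4P[]] /eqP ->.
- apply: (@small_num_nondivp _ _ 1%N 1%N pp (h 1%N isT)); rewrite b0; left; lra.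
- apply: (@small_num_nondivp _ _ 1%N 6 pp (h 1%N isT)); rewrite b2; left; lra.
- apply: (@small_num_nondivp _ _ 1%N 30 pp (h 1%N isT)); rewrite b4; right; lra.
- apply: (@small_num_nondivp _ _ 1%N 42 pp (h 1%N isT)); rewrite b6; left; lra.
- apply: (@small_num_nondivp _ _ 1%N 30 pp (h 1%N isT)); rewrite b8; right; lra.
- apply: (@small_num_nondivp _ _ 5 66 pp (h 5 isT)); rewrite b10; left; lra.
- apply: (@small_num_nondivp _ _ 7 6 pp (h 7 isT)); rewrite b14; left; lra.
Qed.

Lemma dvdz_numq_pint p (x : rat) : prime p -> x / p%:R \is a pint p -> (p%:Z %| numq x)%Z.
Proof.
move=> pp h; have p0 : p%:R != 0 :> rat by rewrite pnatr_eq0 -lt0n prime_gt0.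
case/pintP: h => n [d [cd [d0 e]]].
have d1 : d%:R != 0 :> rat by rewrite pnatr_eq0 -lt0n.
have : numq x * d%:Z = p%:Z * n * denq x.
  apply: (@intr_inj rat); rewrite !intrM numqE -!pmulrn -{1}(divfK p0 x) e.
  by field.
move/(congr1 absz); rewrite !abszM !absz_nat => h.
by rewrite dvdzE absz_nat -(Gauss_dvdl _ cd) h -mulnA dvdn_mulr.
Qed.

Theorem theorem3 (B : nat -> rat) (hB : bernoulli_numbers B)
    (a k m : nat) (ha : (0 < a)%N) (hm : (1 < m)%N)
    (hk : (0 < k)%N) (hk2 : ~~ odd k)
    (heq : (a * T k m = (2 * m + 1) ^ k)%N)
    (p : nat) (hp : prime p) (hpm : (p %| 2 * m + 1)%N) :
  [/\ irregular B p,
      (forall c : nat, c \in [:: 0; 2; 4; 6; 8; 10; 14]%N ->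
         k <> c %[mod p - 1])%N,
      padic_ord p (B k / k%:R) >= 2 * padic_ord p (2 * m + 1)%:R /\
      2 * padic_ord p (2 * m + 1)%:R >= 2
    & exists r : nat, irregular_pair B r p /\ (k = r %[mod p - 1])%N].
Proof.
have rec : bernoulli_recurrence B by exact: bernoulli_rec.
have hodd n : odd n -> n != 1%N -> B n = 0 by exact: bernoulli_odd.
have k3 : (3 < k)%N.
  have [k2|k2] := eqVneq k 2; first by case: (@T2_ndvd a m hm); move: heq; rewrite k2.
  by move: hk hk2 k2; case: k {heq} => [|[|[|[|]]]].
have op : odd p.
  case: (even_prime hp) => // p2; move: hpm; rewrite p2 dvdn2 oddD oddM //.
have p2 : (2 < p)%N by case: p op hp {hpm} => [|[|[|]]].
have ep1 : ~~ odd (p - 1) by rewrite oddB ?prime_gt0 // op.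
have N0 : (0 < 2 * m + 1)%N by rewrite addn1.
have T0 : (0 < T k m)%N by apply: leq_trans (T_ge _ _); rewrite ?expn_gt0 //; lia.
set N := (2 * m + 1)%N in hpm heq N0 *.
have e0 : (0 < logn p N)%N by rewrite logn_gt0 mem_primes hp hpm N0.
have t3 : (3 * logn p N <= logn p (T k m))%N by apply: logn_T_ge heq.
have kk : k.-1.+1 = k by rewrite prednK.
have okk : odd k.-1 by move: hk2; rewrite -{1}kk /= negbK.
(* Otherwise p divides the denominator of B_k, whereas the order of T_k(m) makes B_k p-integral. *)
have npk : ~~ (p - 1 %| k)%N.
  apply/negP => pk; have /negP := bernoulli_nonint rec hp p2 hk pk; apply.
  have := @bernoulli_pint_of_T B rec hodd p k.-1 m; rewrite kk; apply=> //.
  by apply: pint_div_logn => //; apply: leq_trans t3; rewrite leq_pmull.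
(* For p = 3 the even number k would be divisible by p-1. *)
have p5 : (4 < p)%N.
  have p3 : p != 3 by apply: contra npk => /eqP ->; rewrite dvdn2.
  by move: p2 p3 op; case: p {hp hpm e0 t3 npk ep1} => [|[|[|[|[|]]]]].
have ts : (3 * logn p N + logn p k <= logn p (T k m))%N by apply: logn_T_ge_strong heq.
have [u _ eN] := pfactor_coprime hp N0.
set e := logn p N in e0 t3 ts eN *.
have eN' : (N = p * p ^ e.-1 * u)%N by rewrite -expnS prednK // mulnC.
have w0 : (0 < p ^ e.-1)%N by rewrite expn_gt0 prime_gt0.
have hT : (T k m)%:R / (k%:R * N%:R) / (p * p ^ e.-1)%:R ^+ 2 \is a pint p.
  rewrite -expnS prednK // -mulrA -invfM -natrX -!natrM.
  apply: pint_div_logn => //.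
    by rewrite !muln_gt0 hk N0 !expn_gt0 prime_gt0.
  rewrite !lognM ?muln_gt0 ?hk ?N0 ?expn_gt0 ?(prime_gt0 hp) //.
  by rewrite pfactorK // -/e; lia.
have bound := @bernoulli_bound B rec hodd p (p ^ e.-1) u k.-1 m.
(* With x = p the order of B_k / k is at least 2e-1, hence at least 1. *)
have weak : B k / k%:R / p%:R \is a pint p.
  have p0 : p%:R != 0 :> rat by rewrite pnatr_eq0 -lt0n prime_gt0.
  have w1 : (p ^ e.-1)%:R != 0 :> rat by rewrite pnatr_eq0 -lt0n.
  have h : p%:R * (B k / k%:R / (p * p ^ e.-1)%:R ^+ 2) \is a pint p.
    have := bound p%:R; rewrite kk; apply => //; first by lia.
      exact: rpred_nat.
    exact: von_staudt_int.
  have -> : B k / k%:R / p%:R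
      = p%:R * (B k / k%:R / (p * p ^ e.-1)%:R ^+ 2) * (p ^ e.-1)%:R ^+ 2.
    by rewrite natrM; move: (B k / _) (_ ^ _)%:R w1 {h} => b w w1; field; rewrite p0 w1.
  by apply: rpredM => //; apply: rpredX; exact: rpred_nat.
(* As p-1 is even and does not divide k, this residue is even, nonzero and at most p-3. *)
pose r := (k %% (p - 1))%N.
have kr : (k = r %[mod p - 1])%N by rewrite /r modn_mod.
have er : ~~ odd r.
  have := congr1 odd (divn_eq k (p - 1)); rewrite oddD oddM (negPf ep1) andbF /= -/r => <-.
  exact: hk2.
have r0 : (0 < r)%N by rewrite lt0n.
have r1 : (1 < r)%N by move: r0 er; case: (r) => [|[|]].
have rp : (r <= p - 3)%N.
  have : (r < p - 1)%N by rewrite ltn_mod; lia.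
  move: er ep1; move: (r) => z; clear -p2; lia.
have transfer c : (1 < c)%N -> (k = c %[mod p - 1])%N -> B c / p%:R \is a pint p.
  by move=> c1 kc; apply: bernoulli_div_mod weak => //; apply: ltn_trans k3.
have ip : irregular_pair B r p.
  by split => //; apply: dvdz_numq_pint => //; exact: transfer.
(* For p = 5 or 7 the index r is 2 or 4, and B_2 and B_4 have numerators 1 and -1. *)
have p11 : (10 < p)%N.
  rewrite ltnNge; apply/negP => p10.
  have r4 : (r <= 4)%N.
    have p9 : p != 9 by apply: contraTneq hp => ->.
    by apply: leq_trans rp _; move: op p9 p10; clear; lia.
  have h24 : r \in [:: 2; 4].
    by move: r1 er r4; clear; case: r => [|[|[|[|[|]]]]].
  by move/negP: (bernoulli24_nondivp rec hodd hp h24); apply; exact: transfer.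
have hb c : c \in [:: 0; 2; 4; 6; 8; 10; 14]%N -> (k <> c %[mod p - 1])%N.
  move=> hc kc; have [c1|c1] := leqP c 1.
    have c0 : c = 0%N by move: hc c1; case: c {kc} => [|[|]].
    by move: npk; rewrite /dvdn kc c0 mod0n.
  (* The congruence is moved to c itself, which need not be smaller than p-1. *)
  by have /negP := bernoulli_listed_nondivp rec hodd hp p11 hc; apply; exact: transfer.
split=> //; [by split=> //; exists r | split | by exists r].
(* The excluded residue c = 2 shows that p-1 does not divide k-2, so B_(k-2) is p-integral and x = 1
   is allowed. *)
- have strong : B k / k%:R / (p * p ^ e.-1)%:R ^+ 2 \is a pint p.
    have := bound 1; rewrite kk !mul1r; apply=> //; first by lia.
      exact: rpred1.
    apply: bernoulli_pint => //; apply/negP => hd; apply: (hb 2) => //.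
    apply/eqP; rewrite eqn_mod_dvd ?(ltnW (ltnW k3)) //.
    by move: hd; have -> : (k.-1 - 1 = k - 2)%N by lia.
  rewrite padic_ord_nat -/e.
  have -> : 2 * e%:Z = (2 * e)%N%:Z by lia.
  apply: padic_ord_ge => //.
    by rewrite mulf_neq0 ?invr_eq0 ?pnatr_eq0 -?lt0n // bernoulli_neq0.
  by move: strong; rewrite -expnS prednK // natrX -exprM mulnC.
- rewrite padic_ord_nat -/e; lia.
Qed.
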